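(* Let $n,k,t$ be positive integers with $k<n$, let $q$ be a prime power, and let $\mathcal{D}$ be the Desarguesian $(t-1)$-spread of $\mathrm{PG}(nt-1,q)$. Let $\Omega$ be an $(nt-kt-2)$-dimensional subspace of $\mathrm{PG}(nt-1,q)$, let $\Gamma$ be a plane of $\mathrm{PG}(nt-1,q)$ skew from $\Omega$, and let $\bar{B}$ be a minimal blocking set (with respect to lines) of the plane $\Gamma$ such that every point of $\bar{B}$ lies on at least $2$ tangent lines to $\bar{B}$ in $\Gamma$. Let $K$ be the cone with vertex $\Omega$ and base $\bar{B}$. Then $\mathcal{B}(K)$ is a minimal blocking set with respect to $(k-1)$-dimensional subspaces of $\mathrm{PG}(n-1,q^t)$.
   Context: Field reduction: each point of $\mathrm{PG}(n-1,q^t)$ is a $1$-dimensional $\mathbb{F}_{q^t}$-subspace of $\mathbb{F}_{q^t}^n$, which is a $t$-dimensional $\mathbb{F}_q$-subspace of $\mathbb{F}_q^{nt}$, i.e. a $(t-1)$-dimensional subspace of $\mathrm{PG}(nt-1,q)$; the set $\mathcal{D}$ of all these $(t-1)$-spaces partitions the points of $\mathrm{PG}(nt-1,q)$ and is called the Desarguesian $(t-1)$-spread. For $U\subseteq \mathrm{PG}(nt-1,q)$, $\mathcal{B}(U)$ denotes the set of elements of $\mathcal{D}$ meeting $U$, identified with the corresponding set of points of $\mathrm{PG}(n-1,q^t)$. The cone with vertex a subspace $\Omega$ and base a point set $\bar{B}$ contained in a subspace skew from $\Omega$ is $\bigcup_{P\in\bar{B}}\langle P,\Omega\rangle$. A blocking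 set with respect to $j$-spaces is a set of points meeting every $j$-dimensional subspace; it is minimal if no proper subset has this property. A tangent line to a planar point set $\bar{B}$ is a line meeting $\bar{B}$ in exactly one point. *)

(* Defs.v *)
From HB Require Import structures.
From mathcomp Require Import all_boot all_order all_algebra all_field.
Set Implicit Arguments. Unset Strict Implicit. Unset Printing Implicit Defensive.
Import GRing.Theory.
Local Open Scope ring_scope.

(* Model: F = F_q (finite field, q = #|F|), L = F_{q^t} as a field extension
   of F with t = \dim {:L}.  PG(nt-1,q) is the projective space of the
   F-vector space V = L^n = {ffun 'I_n -> L} (F-dimension n*t); its projective
   subspaces of dimension d are the F-subspaces U : {vspace V} with \dim U = d+1.
   PG(n-1,q^t) is the projective space of the L-vector space 'rV[L]_n; its points
   are represented by nonzero row vectors, and its (k-1)-dimensional subspaces by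
   matrices of rank k (row spaces). *)

Section Geometry.
Variables (F : finFieldType) (L : fieldExtType F) (n : nat).

Definition VF := {ffun 'I_n -> L}.

(* a point set of PG(nt-1,q): a predicate on subspaces, only its 1-dim members
   (the points) matter *)
Definition ptsetF := {vspace VF} -> Prop.

Definition is_pointF (P : {vspace VF}) := \dim P = 1%N.
Definition is_lineF (l : {vspace VF}) := \dim l = 2%N.
Definition is_planeF (G : {vspace VF}) := \dim G = 3%N.

Definition blocking_in_plane (G : {vspace VF}) (B : ptsetF) :=
  (forall P, B P -> is_pointF P /\ (P <= G)%VS) /\
  (forall l, is_lineF l -> (l <= G)%VS ->
     exists2 P, B P & (P <= l)%VS).

Definition minimal_blocking_in_plane (G : {vspace VF}) (B : ptsetF) :=
  blocking_in_plane G B /\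
  (forall B' : ptsetF, (forall P, B' P -> B P) -> blocking_in_plane G B' ->
     forall P, B P -> B' P).

Definition tangent_at (G : {vspace VF}) (B : ptsetF) (l P : {vspace VF}) :=
  [/\ is_lineF l, (l <= G)%VS, B P, (P <= l)%VS &
      forall Q, B Q -> (Q <= l)%VS -> Q = P].

Definition cone (Om : {vspace VF}) (B : ptsetF) : ptsetF :=
  fun P => is_pointF P /\ exists2 X, B X & (P <= Om + X)%VS.

(* the Desarguesian spread element of the point <v>_{q^t} of PG(n-1,q^t):
   the F-subspace { c v | c in L } of V *)
Definition spread_elt (v : 'rV[L]_n) : {vspace VF} :=
  <<[seq ([ffun i => b * v ord0 i] : VF)%R | b : L <- vbasis {: L}%VS]>>%VS.

Definition ptsetL := 'rV[L]_n -> Prop.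

Definition Bset (U : ptsetF) : ptsetL :=
  fun v => v != 0 /\ exists2 P, U P & (is_pointF P /\ (P <= spread_elt v)%VS).

Definition proj_set (S : ptsetL) :=
  (forall v, S v -> v != 0) /\ (forall v c, S v -> c != 0 -> S (c *: v)).

(* blocking set w.r.t. (j-1)-dimensional subspaces (= rank-j row spaces) *)
Definition blockingL (j : nat) (S : ptsetL) :=
  proj_set S /\
  forall W : 'M[L]_n, \rank W = j -> exists2 v, S v & (v <= W)%MS.

Definition minimal_blockingL (j : nat) (S : ptsetL) :=
  blockingL j S /\
  (forall S' : ptsetL, (forall v, S' v -> S v) -> blockingL j S' ->
     forall v, S v -> S' v).

End Geometry.

(* Main.v *)
(* Put q = #|F|, t = [L : F] and T = <Om, G>.  A space W of rank k has F-dimension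
   k t, so it meets T in F-dimension at least 2; projecting from Om onto G gives a
   line of G (or a point of Om in W), hence W meets the cone.

   For minimality, let v be a point of Bset (cone Om B), with a point P <= <Om, X> of
   the cone in its spread element D.  Counting yields an L-space A of rank j
   containing v with A /\ T <= D, as long as dimensions allow.  If D /\ T has
   F-dimension at least 2, j = k is allowed and A is tangent to the cone at v.
   Otherwise D /\ T = P and j = k - 1.  Let l1, l2 be tangents at X, Zi = <A, Om, li>,
   Z0 = <A, Om, X> and Z = <A, T>.  Then S = Z0 \/ (Z minus (Z1 \/ Z2)) has
   q^((n-1)t-1) ((q-1)^2 + 1) elements, too few for its L-multiples to cover L^n, so
   some w has no nonzero L-multiple in S.  Then <A, w> is tangent at v: if x = a + c w
   is on the cone with c <> 0, then c w is in some Zi but not in Z0; hence x is in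
   T /\ Zi = <Om, li>, and as li is tangent at X, x is in <Om, X>, so c w is in Z0. *)
Require Import Defs.
From HB Require Import structures.
From mathcomp Require Import all_boot all_order all_algebra all_field.
From mathcomp Require Import zify.
Set Implicit Arguments. Unset Strict Implicit. Unset Printing Implicit Defensive.
Import GRing.Theory.
Local Open Scope ring_scope.

(** * Field reduction: L-row spaces viewed as F-subspaces *)

Section FieldReduction.
Variables (F : finFieldType) (L : fieldExtType F).

Definition to_row n (x : VF L n) : 'rV[L]_n := \row_i x i.
Definition of_row n (v : 'rV[L]_n) : VF L n := [ffun i => v 0 i].

Lemma to_rowK n : cancel (@to_row n) (@of_row n).
Proof. by move=> x; apply/ffunP=> i; rewrite ffunE mxE. Qed.

Lemma of_rowK n : cancel (@of_row n) (@to_row n).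
Proof. by move=> v; apply/rowP=> i; rewrite mxE ffunE. Qed.

Lemma of_row_eq0 n (v : 'rV[L]_n) : (of_row v == 0) = (v == 0).
Proof.
apply/eqP/eqP=> [v0 | ->]; last by apply/ffunP=> i; rewrite !ffunE mxE.
by rewrite -[v]of_rowK v0; apply/rowP=> i; rewrite !mxE ffunE.
Qed.

Lemma of_row0 n : of_row (0 : 'rV[L]_n) = 0.
Proof. by apply/eqP; rewrite of_row_eq0. Qed.

Lemma of_rowD n (u v : 'rV[L]_n) : of_row (u + v) = of_row u + of_row v.
Proof. by apply/ffunP=> i; rewrite !ffunE mxE. Qed.

Lemma of_rowZ n (a : F) (v : 'rV[L]_n) : of_row (a%:A *: v) = a *: of_row v.
Proof. by apply/ffunP=> i; rewrite !ffunE mxE mulr_algl. Qed.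

Definition mulrowF r n (M : 'M[L]_(r, n)) (x : VF L r) : VF L n :=
  of_row (to_row x *m M).

Lemma mulrowF_is_linear r n (M : 'M[L]_(r, n)) : linear (mulrowF M).
Proof.
move=> a x y; apply/ffunP=> i; rewrite !ffunE !mxE scaler_sumr -big_split /=.
by apply: eq_bigr => j _; rewrite !mxE !ffunE mulrDl scalerAl.
Qed.

HB.instance Definition _ r n (M : 'M[L]_(r, n)) :=
  GRing.isLinear.Build F (VF L r) (VF L n) *:%R (mulrowF M) (mulrowF_is_linear M).

(** Taking the image of an F-linear map on L^r lets the F-dimension follow from injectivity once M
    is replaced by a row basis. *)
Definition rowspaceF r n (M : 'M[L]_(r, n)) : {vspace VF L n} :=
  limg (linfun (mulrowF M)).

Lemma mem_rowspaceF r n (M : 'M[L]_(r, n)) x :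
  (x \in rowspaceF M) = (to_row x <= M)%MS.
Proof.
apply/memv_imgP/submxP=> [[y _ ->] | [y xE]].
  by exists (to_row y); rewrite lfunE /= of_rowK.
exists (of_row y); first exact: memvf.
by rewrite lfunE /= /mulrowF of_rowK -xE to_rowK.
Qed.

Lemma mem_of_row r n (M : 'M[L]_(r, n)) v :
  (of_row v \in rowspaceF M) = (v <= M)%MS.
Proof. by rewrite mem_rowspaceF of_rowK. Qed.

Lemma rowspaceF_sub r1 r2 n (M : 'M[L]_(r1, n)) (N : 'M[L]_(r2, n)) :
  (M <= N)%MS -> (rowspaceF M <= rowspaceF N)%VS.
Proof.
by move=> sMN; apply/subvP=> x; rewrite !mem_rowspaceF => /submx_trans->.
Qed.

Lemma dim_VF n : \dim {:VF L n} = (n * \dim {:L})%N.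
Proof. by rewrite !dimvf /dim /= card_ord. Qed.

Lemma dim_rowspaceF r n (M : 'M[L]_(r, n)) :
  \dim (rowspaceF M) = (\rank M * \dim {:L})%N.
Proof.
have -> : rowspaceF M = rowspaceF (row_base M).
  by apply/vspaceP=> x; rewrite !mem_rowspaceF eq_row_base.
rewrite /rowspaceF limg_dim_eq ?dim_VF //; apply/eqP; rewrite -subv0.
apply/subvP=> x; rewrite memv_cap memv_ker memv0 lfunE /= => /andP[_].
rewrite of_row_eq0 mulmx_free_eq0 ?row_base_free // -of_row_eq0.
by rewrite to_rowK.
Qed.

Lemma spread_eltE n (v : 'rV[L]_n) : spread_elt v = rowspaceF v.
Proof.
have sE (c : L) : ([ffun i => c * v ord0 i] : VF L n) = of_row (c *: v).
  by apply/ffunP=> i; rewrite !ffunE mxE.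
apply/eqP; rewrite eqEsubv; apply/andP; split.
  apply/span_subvP=> x /mapP[b _ ->].
  by rewrite sE mem_of_row scalemx_sub.
apply/subvP=> x; rewrite mem_rowspaceF => /sub_rVP[c xE].
(* Expanding the scalar c in the F-basis of L writes c v as an F-combination of the generators. *)
rewrite -[x]to_rowK xE (coord_vbasis (memvf c)) scaler_suml.
rewrite (big_morph _ (@of_rowD n) (of_row0 n)).
apply: memv_suml => i _; rewrite -[_ *: (vbasis _)`_i]mulr_algl -scalerA of_rowZ.
apply/memvZ/memv_span/mapP; exists (vbasis {:L})`_i; last by rewrite sE.
by rewrite mem_nth ?size_tuple.
Qed.

(** * Counting vectors and L-multiples *)

Lemma card_finvect (vT : vectType F) : #|finvect_type vT| = (#|F| ^ \dim {:vT})%N.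
Proof.
rewrite -(card_vspace (fullv : {vspace finvect_type vT})).
exact/esym/(@card_vspacef F (finvect_type vT)).
Qed.

(* Counting the pairs (c, c w) with c in L^* and c w in S: each w yields at
   least q - 1 of them, because S is closed under F^*. *)
Lemma exists_row_avoiding n (S : {set finvect_type (VF L n)}) :
  (forall (a : F) x, a != 0 -> x \in S ->
    (a *: (x : VF L n) : finvect_type (VF L n)) \in S) ->
  ((#|F| ^ \dim {:L}).-1 * #|S| < #|F|.-1 * #|F| ^ (n * \dim {:L}))%N ->
  exists w : 'rV[L]_n, forall c : L, c != 0 ->
    (of_row (c *: w) : finvect_type (VF L n)) \notin S.
Proof.
move=> SF ltS; pose T := finvect_type (VF L n); pose E := finvect_type L.
case: (pickP [pred w : T | [forall c : E, (c != 0) ==>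
   (of_row ((c : L) *: to_row (w : VF L n)) \notin S)]]) => [w /= /forallP wP|noW].
  by exists (to_row (w : VF L n)) => c c0; have /implyP := wP c; apply.
have hc (w : T) : {c : E | (c != 0) && (of_row ((c : L) *: to_row (w : VF L n)) \in S)}.
  apply: sigW; have /negbT := noW w; rewrite negb_forall => /existsP[c].
  by rewrite negb_imply negbK; exists c.
pose g (w : T) : L := sval (hc w).
(* The first component records the nonzero scalar [a * g w]; dividing the second by it recovers w,
   and then a, so [h] is injective. *)
pose h (p : F * T) : E * T := (p.1 *: g p.2, of_row ((p.1%:A * g p.2) *: to_row p.2)).
have g0 w : g w != 0 by rewrite /g; case: (hc w) => c /= /andP[].
pose A := setX [set~ (0 : F)] [set: T]; pose B := setX [set~ (0 : E)] S.
have injh : {in A &, injective h}.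
  move=> [a w] [b u]; rewrite !inE /= !andbT => a0 b0 [e1 e2].
  have nz : a%:A * g w != 0 by rewrite mulr_algl scaler_eq0 negb_or a0 g0.
  have ewu : w = u.
    apply: (can_inj (@to_rowK n)); apply: (scalerI nz).
    by rewrite (can_inj (@of_rowK n) e2) !mulr_algl e1.
  by move: e1; rewrite ewu => /eqP; rewrite -subr_eq0 -scalerBl scaler_eq0
    (negPf (g0 u)) orbF subr_eq0 => /eqP->.
have /subset_leq_card : h @: A \subset B.
  apply/subsetP=> _ /imsetP[[a w] /[!inE]/= /andP[a0 _] ->].
  rewrite scaler_eq0 negb_or a0 g0 /= -scalerA of_rowZ SF //.
  by rewrite /g; case: (hc w) => c /= /andP[].
rewrite card_in_imset // !cardsX !cardsC1 cardsT !card_finvect dim_VF.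
by rewrite leqNgt ltS.
Qed.

Lemma mem_rowspaceF_addP r n (A : 'M[L]_(r, n)) (w : 'rV[L]_n) x :
  x \in rowspaceF (A + w)%MS ->
  exists c : L, x - of_row (c *: w) \in rowspaceF A.
Proof.
rewrite mem_rowspaceF => /sub_addsmxP[[u1 u2] /= xE]; exists (u2 0 0).
rewrite -[x]to_rowK xE {1}[u2]mx11_scalar mul_scalar_mx of_rowD addrK.
by rewrite mem_of_row submxMl.
Qed.

Lemma dimL_gt0 : (0 < \dim {:L})%N.
Proof. exact: adim_gt0. Qed.

Lemma cardF_gt1 : (1 < #|F|)%N.
Proof. exact: finNzRing_gt1. Qed.

Definition setv n (U : {vspace VF L n}) : {set finvect_type (VF L n)} :=
  [set x : finvect_type (VF L n) | (x : VF L n) \in U].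

Lemma mem_setv n (U : {vspace VF L n}) (x : VF L n) :
  ((x : finvect_type (VF L n)) \in setv U) = (x \in U).
Proof. by rewrite inE. Qed.

Lemma card_setv n (U : {vspace VF L n}) : #|setv U| = (#|F| ^ \dim U)%N.
Proof.
rewrite -(card_vspace (U : {vspace finvect_type (VF L n)})).
by apply: eq_card => x; rewrite inE.
Qed.

(** * Extending L-subspaces while controlling an intersection *)

Lemma mxrank_add_row r n (A : 'M[L]_(r, n)) (w : 'rV[L]_n) :
  ~~ (w <= A)%MS -> \rank (A + w)%MS = (\rank A).+1.
Proof.
move=> nwA; have w0 : w != 0 by apply: contraNneq nwA => ->; apply: sub0mx.
have := mxrank_sum_cap A w; rewrite rank_rV w0 addn1.
suff -> : \rank (A :&: w)%MS = 0%N by rewrite addn0.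
(* The bound 1 is read as the boolean [w != 0], which is the rank of w. *)
apply/eqP; rewrite -leqn0 -ltnS -[ltnRHS]/(true : nat) -w0 -rank_rV.
rewrite (ltn_leqif (mxrank_leqif_sup (capmxSr A w))).
by apply: contra nwA => /submx_trans->//; apply: capmxSl.
Qed.

(** If A + T has F-codimension at least t, its L-multiples cannot cover L^n, so some w has no
    nonzero multiple in it. A vector a + c w of T with c nonzero would put c w in A + T. *)
Lemma exists_adds_row n (A : 'M[L]_n) (T : {vspace VF L n}) :
  (\dim (rowspaceF A + T) + \dim {:L} <= n * \dim {:L})%N ->
  exists2 w : 'rV[L]_n, ~~ (w <= A)%MS &
    (rowspaceF (A + w)%MS :&: T <= rowspaceF A)%VS.
Proof.
move=> dimAT; have [||w wP] := @exists_row_avoiding n (setv (rowspaceF A + T)).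
- by move=> a x _; rewrite !mem_setv; apply: memvZ.
- have q0 : (0 < #|F|)%N := ltnW cardF_gt1.
  rewrite card_setv (@leq_trans (#|F| ^ (n * \dim {:L}))%N) //; last first.
    by rewrite leq_pmull // -ltnS prednK ?cardF_gt1.
  apply: leq_trans (leq_pexp2l q0 dimAT); rewrite addnC expnD.
  by rewrite ltn_pmul2r ?expn_gt0 ?q0 // prednK ?leqnn // expn_gt0 q0.
have wA c : c != 0 -> of_row (c *: w) \notin (rowspaceF A + T)%VS.
  by move/wP; rewrite mem_setv.
exists w.
  have := wA 1 (oner_neq0 _); rewrite scale1r -mem_of_row; apply: contra.
  exact/subvP/addvSl.
apply/subvP=> x; rewrite memv_cap => /andP[/mem_rowspaceF_addP[c xA] xT].
have [c0 | c0] := eqVneq c 0.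
  by move: xA; rewrite c0 scale0r of_row0 subr0.
case/negP: (wA c c0); rewrite -[of_row _](subKr x) addrC.
by rewrite memv_add // memvN.
Qed.

(** Each added row leaves A /\ T equal to its initial value, so dim (A + T) grows by exactly t per
    step; the hypothesis provides room for j steps. *)
Lemma exists_extension_avoiding n j (v : 'rV[L]_n) (T : {vspace VF L n}) :
  v != 0 -> (\dim (rowspaceF v + T) + j * \dim {:L} <= n * \dim {:L})%N ->
  exists A : 'M[L]_n, [/\ \rank A = j.+1, (v <= A)%MS &
    (rowspaceF A :&: T <= rowspaceF v)%VS].
Proof.
move=> v0; elim: j => [|j IHj] dimj.
  exists <<v>>%MS; rewrite mxrank_gen rank_rV v0 genmxE; split=> //.
  by apply: subv_trans (capvSl _ _) _; apply: rowspaceF_sub; rewrite genmxE.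
have [|A [rA vA AT]] := IHj; first by apply: leq_trans dimj; lia.
have capE : (rowspaceF A :&: T = rowspaceF v :&: T)%VS.
  apply/eqP; rewrite eqEsubv [X in _ && X]capvS ?rowspaceF_sub //.
  by rewrite subv_cap AT capvSr.
have [|w wA wT] := @exists_adds_row n A T.
  have := dimv_sum_cap (rowspaceF A) T; have := dimv_sum_cap (rowspaceF v) T.
  rewrite !dim_rowspaceF capE rA rank_rV v0.
  by move: dimj; rewrite !mulSn; lia.
exists (A + w)%MS; rewrite mxrank_add_row // rA.
split=> //; first exact: submx_trans vA (addsmxSl _ _).
apply: subv_trans AT; rewrite subv_cap wT capvSr //.
Qed.

End FieldReduction.

(** * Vector space preliminaries *)

Lemma exists_line (K : fieldType) (vT : vectType K) (U : {vspace vT}) :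
  (1 < \dim U)%N -> exists2 l : {vspace vT}, \dim l = 2 & (l <= U)%VS.
Proof.
move=> dU; exists <<take 2 (vbasis U)>>%VS; last first.
  by apply/span_subvP=> x /mem_take/vbasis_mem.
have := basis_free (vbasisP U); rewrite -[X in free X](cat_take_drop 2).
move/catl_free/eqP=> dim2; rewrite [LHS]dim2 size_take size_tuple.
by case: ifP => //; move: dU; lia.
Qed.

Lemma nonzero_mem (K : fieldType) (vT : vectType K) (U : {vspace vT}) :
  (0 < \dim U)%N -> exists2 x, x \in U & x != 0.
Proof.
by rewrite lt0n dimv_eq0 => U0; exists (vpick U); rewrite ?memv_pick ?vpick0.
Qed.

(** The G-component of a vector of Om + G is unique, as two choices differ by an element of Om /\
    G. *)
Lemma add_skew_cap (K : fieldType) (vT : vectType K) (Om G U1 U2 : {vspace vT}) :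
  (Om :&: G = 0)%VS -> (U1 <= G)%VS -> (U2 <= G)%VS ->
  ((Om + U1) :&: (Om + U2) <= Om + (U1 :&: U2))%VS.
Proof.
move=> skew U1G U2G; apply/subvP=> x /memv_capP[/memv_addP[o1 o1O [u1 u1U ->]]].
case/memv_addP=> o2 o2O [u2 u2U xE]; rewrite memv_add // memv_cap u1U /=.
suff: u1 - u2 \in (Om :&: G)%VS by rewrite skew memv0 subr_eq0 => /eqP->.
rewrite memv_cap [X in _ && X]memvB ?andbT; first last.
- exact: subvP U2G _ u2U.
- exact: subvP U1G _ u1U.
have -> : u1 - u2 = o2 - o1.
  by apply/eqP; rewrite subr_eq addrAC -xE addrAC subrr add0r.
exact: memvB.
Qed.

(** * Subspaces tangent to the cone *)

Section Cone.
Variables (F : finFieldType) (L : fieldExtType F) (n : nat).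
Implicit Types (U Z Om G X Y l : {vspace VF L n}) (u v w : 'rV[L]_n).

Lemma exists_row_meeting_in_hyperplanes m Z Z0 Z1 Z2 :
  \dim Z = m.+2 -> \dim Z0 = m -> \dim Z1 = m.+1 -> \dim Z2 = m.+1 ->
  (Z1 + Z2 = Z)%VS -> (m.+1 + \dim {:L} = n * \dim {:L})%N ->
  exists w, forall c : L, c != 0 -> of_row (c *: w) \notin Z0 /\
    (of_row (c *: w) \in Z -> of_row (c *: w) \in Z1 \/ of_row (c *: w) \in Z2).
Proof.
move=> dZ d0 d1 d2 Z12 dn; set q := #|F|.
pose S := setv Z0 :|: (setv Z :\: (setv Z1 :|: setv Z2)).
have memS (x : VF L n) : ((x : finvect_type (VF L n)) \in S) =
    (x \in Z0) || [&& x \notin Z1, x \notin Z2 & x \in Z].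
  by rewrite !inE negb_or -andbA.
have SF (a : F) x : a != 0 -> x \in S ->
    (a *: (x : VF L n) : finvect_type (VF L n)) \in S.
  move=> a0; have ZE U : (a *: (x : VF L n) \in U) = ((x : VF L n) \in U).
    apply/idP/idP => [|xU]; last exact: memvZ.
    by move/(memvZ a^-1); rewrite scalerA mulVf // scale1r.
  by rewrite !memS !ZE.
have [|w wS] := @exists_row_avoiding F L n S SF; last 1 first.
  exists w => c /wS; rewrite memS negb_or !negb_and !negbK => /andP[-> H].
  by split=> // xZ; case/or3P: H => [|| /negP//]; [left | right].
have q1 : (1 < q)%N := cardF_gt1 F.
(* Inclusion-exclusion: Z1 and Z2 span Z, so they meet in dimension m. *)
have cU : (q ^ m.+1 + q ^ m.+1 = #|setv Z1 :|: setv Z2| + q ^ m)%N.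
  have -> : (q ^ m)%N = #|setv Z1 :&: setv Z2|.
    have -> : setv Z1 :&: setv Z2 = setv (Z1 :&: Z2).
      by apply/setP=> x; rewrite !inE memv_cap.
    rewrite card_setv; congr (_ ^ _)%N; apply/eqP.
    by have := dimv_sum_cap Z1 Z2; rewrite Z12 dZ d1 d2; lia.
  by rewrite cardsUI !card_setv d1 d2.
have cS : (#|S| + q ^ m.+1 + q ^ m.+1 <= q ^ m.+2 + q ^ m + q ^ m)%N.
  have := leq_of_leqif (leq_card_setU (setv Z0) (setv Z :\: (setv Z1 :|: setv Z2))).
  rewrite cardsD (setIidPr _) ?card_setv ?d0 ?dZ -/q => [cS|].
    have : (#|setv Z1 :|: setv Z2| <= q ^ m.+2)%N.
      rewrite -dZ -card_setv subset_leq_card //.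
      apply/subsetP=> x; rewrite !inE -Z12.
      by case/orP; apply: subvP; rewrite ?addvSl ?addvSr.
    move: cS cU; rewrite -/S. lia.
  apply/subsetP=> x; rewrite !inE -Z12.
  by case/orP; apply: subvP; rewrite ?addvSl ?addvSr.
rewrite -/q -dn expnD.
have qt : (0 < q ^ \dim {:L})%N by rewrite expn_gt0 ltnW.
have qm : (0 < q ^ m)%N by rewrite expn_gt0 ltnW.
(* With b = q and a = q^m, this is (q-1)^2 + 1 <= (q-1) q, valid for q >= 2. *)
have arith s a b : (1 < b -> s + b * a + b * a <= b * (b * a) + a + a ->
    s <= b.-1 * (b * a))%N.
  by case: b => [|[|b]] // _; rewrite succnK; nia.
have {}cS : (#|S| <= q.-1 * q ^ m.+1)%N.
  rewrite !expnS in cS *; apply: arith q1 cS.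
apply: (leq_ltn_trans (leq_mul (leqnn _) cS)).
rewrite mulnCA ltn_pmul2l -?subn1 ?subn_gt0 // [ltnRHS]mulnC.
by rewrite ltn_pmul2r ?expn_gt0 ?(ltnW q1) // subn1 prednK.
Qed.

Lemma tangents_cap G (B : ptsetF L n) X l1 l2 :
  is_pointF X -> l1 <> l2 -> tangent_at G B l1 X -> tangent_at G B l2 X ->
  (l1 :&: l2 = X)%VS.
Proof.
move=> dX nl [dl1 _ _ Xl1 _] [dl2 _ _ Xl2 _].
apply/esym/eqP; rewrite eqEdim subv_cap Xl1 Xl2 dX /= -ltnS.
rewrite ltn_neqAle -{2}dl1 dimvS ?capvSl // andbT; apply/eqP=> d2.
apply: nl; transitivity (l1 :&: l2)%VS; apply/eqP.
  by rewrite eq_sym eqEdim capvSl dl1 d2 leqnn.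
by rewrite eqEdim capvSr dl2 d2 leqnn.
Qed.

(* A point of the base other than X misses a tangent line at X, so the
   generator of the cone through it meets <Om, l> only in Om. *)
Lemma cone_cap_tangent Om G (B : ptsetF L n) X Y l :
  (Om :&: G = 0)%VS -> (forall P, B P -> is_pointF P /\ (P <= G)%VS) ->
  tangent_at G B l X -> B Y -> ((Om + Y) :&: (Om + l) <= Om + X)%VS.
Proof.
move=> skew Bpt [_ lG BX Xl lX] BY; have [dY YG] := Bpt _ BY.
apply: subv_trans (add_skew_cap skew YG lG) _; apply: addvS => //.
have [/lX-> // | nYl] := boolP (Y <= l)%VS; first exact: capvSl.
suff -> : (Y :&: l = 0)%VS by apply: sub0v.
apply/eqP; rewrite -dimv_eq0 -leqn0 -ltnS -dY ltn_neqAle dimvS ?capvSl // andbT.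
apply: contra nYl => /eqP dYl; rewrite -(_ : (Y :&: l)%VS = Y) ?capvSr //.
by apply/eqP; rewrite eqEdim capvSl dYl leqnn.
Qed.

(** Such a W has v as its only point in [Bset (cone Om B)], so no blocking subset can omit v. *)
Lemma exists_tangent_rowspace k Om G (B : ptsetF L n) X l1 l2 v (x0 : VF L n) :
  (0 < k)%N -> (k < n)%N ->
  \dim Om = (n * \dim {:L} - k * \dim {:L} - 1)%N ->
  is_planeF G -> (Om :&: G = 0)%VS ->
  (forall P, B P -> is_pointF P /\ (P <= G)%VS) ->
  l1 <> l2 -> tangent_at G B l1 X -> tangent_at G B l2 X ->
  x0 != 0 -> x0 \in (Om + X)%VS -> x0 \in rowspaceF v ->
  exists W : 'M[L]_n, [/\ \rank W = k, (v <= W)%MS &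
    forall Y, B Y -> (rowspaceF W :&: (Om + Y) <= rowspaceF v)%VS].
Proof.
move=> k0 kn dOm dG skew Bpt nl tl1 tl2 x00 x0X x0v.
have [dl1 l1G BX Xl1 _] := tl1; have [dl2 l2G _ Xl2 _] := tl2.
have [dX XG] := Bpt _ BX; have Xcap := tangents_cap dX nl tl1 tl2.
set t := \dim {:L} in dOm *; have t0 : (0 < t)%N := dimL_gt0 L.
have kt : (k * t + t <= n * t)%N by rewrite addnC -mulSn leq_mul2r kn orbT.
have tk : (t <= k * t)%N by rewrite leq_pmull.
have v0 : v != 0.
  apply: contraNneq x00 => v0; move: x0v; rewrite mem_rowspaceF v0.
  by move/submx0null/eqP; rewrite -of_row_eq0 to_rowK.
have dskew U : (U <= G)%VS -> \dim (Om + U) = (\dim Om + \dim U)%N.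
  move=> UG; apply: dimv_disjoint_sum; apply/eqP; rewrite -subv0 -skew.
  exact: capvS.
pose T := (Om + G)%VS; have dT : \dim T = (\dim Om + 3)%N by rewrite dskew // dG.
have dv : \dim (rowspaceF v) = t by rewrite dim_rowspaceF rank_rV v0 mul1n.
have subT U : (U <= G)%VS -> (Om + U <= T)%VS by move=> UG; apply: addvS.
have x0T : (<[x0]> <= rowspaceF v :&: T)%VS.
  by rewrite -memvE memv_cap x0v (subvP (subT _ XG)).
have dx0 : \dim <[x0]> = 1%N by rewrite dim_vline x00.
have dvT := dimv_sum_cap (rowspaceF v) T; rewrite dv dT dOm in dvT.
have [s2 | s1] := leqP 2 (\dim (rowspaceF v :&: T)).
  (* Here dim (v + T) <= nt - (k-1)t, which leaves room for k - 1 extensions. *)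
  have [|W [rW vW WT]] := @exists_extension_avoiding F L n k.-1 v T v0.
    have := mulSn k.-1 t; rewrite prednK // -/t.
    by clear -t0 kt s2 dvT; lia.
  exists W; split; rewrite ?rW ?prednK // => Y /Bpt[_ YG].
  by apply: subv_trans WT; apply: capvS => //; apply: subT.
have vTE : (rowspaceF v :&: T = <[x0]>)%VS.
  by apply/esym/eqP; rewrite eqEdim x0T dx0 -ltnS s1.
rewrite vTE dx0 in dvT.
(* Now dim (v + T) = nt - (k-1)t + 1, which exceeds nt when k = 1. *)
have k2 : (1 < k)%N.
  have := dimvS (subvf (rowspaceF v + T)); rewrite dim_VF -/t => dle.
  rewrite ltnNge; apply/negP=> k1; have := leq_mul k1 (leqnn t).
  by rewrite mul1n; clear -t0 kt dvT dle; lia.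
have kE := mulSn k.-1 t; have kE' := mulSn k.-2 t.
rewrite !prednK ?(ltnW k2) // in kE; rewrite prednK -?subn1 ?subn_gt0 // subn1 in kE'.
(* The extra dimension costs one step: k - 2 extensions end at dimension nt - t + 1 <= nt. *)
have [|A [rA vA AT]] := @exists_extension_avoiding F L n k.-2 v T v0.
  by rewrite -/t; clear -t0 kt dvT kE kE'; lia.
have {}rA : \rank A = k.-1 by rewrite rA prednK // -subn1 subn_gt0.
have x0A : x0 \in rowspaceF A by apply: subvP x0v; apply: rowspaceF_sub.
have capA U : (X <= U)%VS -> (U <= G)%VS -> (rowspaceF A :&: (Om + U) = <[x0]>)%VS.
  move=> XU UG; apply/eqP; rewrite eqEsubv; apply/andP; split.
    rewrite -vTE subv_cap (subv_trans _ AT) ?capvS ?subT //=.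
    exact: subv_trans (capvSr _ _) (subT _ UG).
  by rewrite -memvE memv_cap x0A (subvP (addvS (subvv Om) XU)).
have dA U : (X <= U)%VS -> (U <= G)%VS ->
    (\dim (rowspaceF A + (Om + U)) + 1 = k.-1 * t + (\dim Om + \dim U))%N.
  move=> XU UG; have := dimv_sum_cap (rowspaceF A) (Om + U)%VS.
  by rewrite capA // dx0 dim_rowspaceF rA dskew.
have dZ := dA _ XG (subvv G); have d0 := dA _ (subvv X) XG.
have d1 := dA _ Xl1 l1G; have d2 := dA _ Xl2 l2G.
rewrite dG in dZ; rewrite dX in d0; rewrite dl1 in d1; rewrite dl2 in d2.
have lG : (l1 + l2 = G)%VS.
  apply/eqP; rewrite eqEdim subv_add l1G l2G /= dG.
  by have := dimv_sum_cap l1 l2; rewrite Xcap dl1 dl2 dX addn1 => -[->].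
have [||||||w wP] := @exists_row_meeting_in_hyperplanes (n * t - t - 1)
  (rowspaceF A + (Om + G)) (rowspaceF A + (Om + X)) (rowspaceF A + (Om + l1))
  (rowspaceF A + (Om + l2)); try by rewrite -/t; clear -t0 kt tk kE dOm dZ d0 d1 d2; lia.
  have ACA (U1 U2 U3 U4 : {vspace VF L n}) :
      (U1 + U2 + (U3 + U4) = U1 + U3 + (U2 + U4))%VS.
    by rewrite !addvA -(addvA U1) (addvC U2) addvA.
  by rewrite -lG ACA addvv (ACA Om) addvv.
have nwA : ~~ (w <= A)%MS.
  have [] := wP 1 (oner_neq0 _); rewrite scale1r -mem_of_row => + _.
  by apply: contra; apply/subvP/addvSl.
exists (A + w)%MS; split.
- by rewrite mxrank_add_row // rA prednK.
- exact: submx_trans vA (addsmxSl _ _).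
move=> Y BY; have [_ YG] := Bpt _ BY.
apply/subvP=> x /memv_capP[/mem_rowspaceF_addP[c xA] xY].
have [c0 | c0] := eqVneq c 0.
  have xA' : x \in rowspaceF A.
    by move: xA; rewrite c0 scale0r of_row0 subr0.
  apply: (subvP AT); rewrite memv_cap xA'; exact: (subvP (subT _ YG)).
have cE (U : {vspace VF L n}) : x \in U -> of_row (c *: w) \in (rowspaceF A + U)%VS.
  by move=> xU; rewrite -[of_row _](subKr x) addrC memv_add // memvN.
have [n0 H] := wP c c0.
have {}H : exists2 l, tangent_at G B l X &
    of_row (c *: w) \in (rowspaceF A + (Om + l))%VS.
  by case: H => [|H|H]; [apply/cE/(subvP (subT _ YG)) | exists l1 | exists l2].
have [l tl wl] := H; have [_ lG' _ Xl _] := tl.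
case/negP: n0; apply: cE; apply: (subvP (cone_cap_tangent skew Bpt tl BY)).
rewrite memv_cap xY /=.
have : x \in (rowspaceF A + (Om + l))%VS.
  by rewrite -(subrK (of_row (c *: w)) x) memvD // (subvP (addvSl _ _)).
case/memv_addP=> a aA [y yl xE]; rewrite xE memvD //.
(* The A-component of x lies in A /\ T = <x0>, hence in <Om, l>; this improves x in <A, Om, l> to x
   in <Om, l>. *)
have : a \in (rowspaceF A :&: T)%VS.
  have xT : x \in T by apply: (subvP (subT _ YG)).
  have yT : y \in T by apply: (subvP (subT _ lG')).
  by rewrite memv_cap aA -(addrK y a) -xE memvB.
rewrite capA // -(capA l) //; case/memv_capP=> _; exact.
Qed.

(** * The blocking property *)

Lemma Bset_coneP Om G (B : ptsetF L n) u :
  (forall P, B P -> is_pointF P /\ (P <= G)%VS) ->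
  Bset (cone Om B) u <-> u != 0 /\ exists2 X, B X &
    exists x : VF L n, [/\ x != 0, x \in rowspaceF u & x \in (Om + X)%VS].
Proof.
move=> Bpt; rewrite /Bset spread_eltE; split=> [[u0 [P [dP [X BX PX]] [_ Pu]]] | ].
  split=> //; exists X => //; have [|x xP x0] := @nonzero_mem _ _ P.
    by rewrite dP.
  by exists x; rewrite x0 (subvP Pu) // (subvP PX).
case=> u0 [X BX [x [x0 xu xX]]]; split=> //; exists <[x]>%VS.
  by split; [rewrite /is_pointF dim_vline x0 | exists X; rewrite // -memvE].
by split; [rewrite /is_pointF dim_vline x0 | rewrite -memvE].
Qed.

Lemma Bset_cone_blocking k Om G (B : ptsetF L n) :
  (k <= n)%N -> (n * \dim {:L} - k * \dim {:L} - 1 <= \dim Om)%N ->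
  is_planeF G -> (Om :&: G = 0)%VS -> blocking_in_plane G B ->
  blockingL k (Bset (cone Om B)).
Proof.
move=> kn dOm dG skew [Bpt Bl]; split.
  split=> [v [] // | v c /(Bset_coneP _ _ Bpt)[v0 [X BX [x [x0 xv xX]]]] c0].
  apply/(Bset_coneP _ _ Bpt); split; first by rewrite scaler_eq0 negb_or c0.
  exists X => //; exists x; split=> //; move: xv; rewrite !mem_rowspaceF.
  by rewrite (eqmx_scale _ c0).
move=> W rW; pose R := rowspaceF W.
suff [Y BY [x [x0 xR xY]]] : exists2 Y, B Y &
    exists x : VF L n, [/\ x != 0, x \in R & x \in (Om + Y)%VS].
  exists (to_row x); last by rewrite -mem_rowspaceF.
  apply/(Bset_coneP _ _ Bpt); split; first by rewrite -of_row_eq0 to_rowK.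
  by exists Y => //; exists x; rewrite mem_rowspaceF submx_refl.
have line_meets U : (1 < \dim U)%N -> (U <= G)%VS ->
    exists2 Y, B Y & (Y <= U)%VS.
  move=> /exists_line[l dl lU] UG; have [Y BY Yl] := Bl l dl (subv_trans lU UG).
  by exists Y => //; apply: subv_trans lU.
(* If R meets Om, any base point serves, since every generator contains Om. *)
have [RO | /eqP RO] := boolP ((R :&: Om)%VS == 0%VS); last first.
  have [|Y BY _] := line_meets G _ (subvv G); first by rewrite dG.
  have [|x] := @nonzero_mem _ _ (R :&: Om); first by rewrite lt0n dimv_eq0; apply/eqP.
  rewrite memv_cap => /andP[xR xO] x0; exists Y => //; exists x; split=> //.
  exact: (subvP (addvSl _ _)).
have dT : \dim (Om + G) = (\dim Om + 3)%N by rewrite dimv_disjoint_sum // dG.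
have dR : \dim R = (k * \dim {:L})%N by rewrite dim_rowspaceF rW.
pose M := (R :&: (Om + G))%VS.
have dM : (1 < \dim M)%N.
  have := dimv_sum_cap R (Om + G)%VS; have := dimvS (subvf (R + (Om + G))).
  have : (k * \dim {:L} <= n * \dim {:L})%N by rewrite leq_mul2r kn orbT.
  rewrite dim_VF dT dR -/M; clear -dOm; lia.
(* This is the projection of M from Om onto G; it keeps dimension at least 2 because M /\ Om = 0. *)
have [|Y BY] := line_meets ((M + Om) :&: G)%VS _ (capvSr _ _).
  have := dimv_sum_cap (M + Om)%VS G; have := dimv_sum_cap M Om.
  have -> : (M :&: Om = 0)%VS.
    apply/eqP; rewrite -subv0 -(eqP RO) capvS ?capvSl //.
  have /dimvS : (M + Om + G <= Om + G)%VS.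
    by rewrite !subv_add capvSr addvSl addvSr.
  by rewrite dT dG dimv0; clear -dM; lia.
rewrite subv_cap => /andP[YM YG]; exists Y => //.
have [|y yY y0] := @nonzero_mem _ _ Y; first by have [-> _] := Bpt _ BY.
have /memv_addP[r rM [o oO yE]] := subvP YM _ yY.
have rE : r = y - o by rewrite yE addrK.
exists r; split; last 1 first.
- by rewrite rE addrC memv_add // memvN.
- apply: contraNneq y0 => r0; rewrite -memv0 -skew memv_cap (subvP YG) // andbT.
  by rewrite yE r0 add0r.
by have /memv_capP[] := rM.
Qed.

End Cone.

(** * Minimality from tangent subspaces *)

Theorem theorem4p4 (F : finFieldType) (L : fieldExtType F) (n k : nat)
  (Om G : {vspace VF L n}) (B : ptsetF L n) :
  (0 < k)%N -> (k < n)%N ->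
  \dim Om = (n * \dim {:L} - k * \dim {:L} - 1)%N ->
  is_planeF G -> (Om :&: G = 0)%VS ->
  minimal_blocking_in_plane G B ->
  (forall P, B P -> exists l1 l2, l1 <> l2 /\ tangent_at G B l1 P /\ tangent_at G B l2 P) ->
  minimal_blockingL k (Bset (cone Om B)).
Proof.
move=> k0 kn dOm dG skew [Bbl _] tgt; have [Bpt _] := Bbl.
split; first by apply: (Bset_cone_blocking (ltnW kn) _ dG); rewrite ?dOm.
move=> S' S'S [[_ S'Z] S'bl] v /(Bset_coneP _ _ Bpt)[v0 [X BX [x0 [x00 x0v x0X]]]].
have [l1 [l2 [nl [tl1 tl2]]]] := tgt X BX.
have [W [rW vW Wcap]] :=
  exists_tangent_rowspace k0 kn dOm dG skew Bpt nl tl1 tl2 x00 x0X x0v.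
have [u S'u uW] := S'bl W rW.
have /(Bset_coneP _ _ Bpt)[u0 [Y BY [x [xn0 xu xY]]]] := S'S _ S'u.
have xv : x \in rowspaceF v.
  apply: (subvP (Wcap Y BY)); rewrite memv_cap xY andbT.
  by apply: subvP xu; apply: rowspaceF_sub.
have xr0 : to_row x != 0 by rewrite -of_row_eq0 to_rowK.
(* The spread elements of u and v share the nonzero x, so v is an L-multiple of u and lies in [S']
   with it. *)
move: xu xv; rewrite !mem_rowspaceF => /sub_rVP[a aE] /sub_rVP[b bE].
have a0 : a != 0 by apply: contraNneq xr0 => a0; rewrite aE a0 scale0r.
have b0 : b != 0 by apply: contraNneq xr0 => b0; rewrite bE b0 scale0r.
have -> : v = (b^-1 * a) *: u by rewrite -scalerA -aE bE scalerA mulVf // scale1r.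
by apply: S'Z; rewrite // mulf_neq0 ?invr_eq0.
Qed.
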